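(* For each integer $n\ge 1$, let $C_{2n+2}$ be the bouquet with edge set $\{1,2,\dots,2n+2\}$ and signed rotation $$(1,\,2,\,3,\,4,\,5,\,6,\,\dots,\,2n+1,\,2n+2,\,-2,\,-1,\,2n+1,\,2n+2,\,\dots,\,5,\,6,\,3,\,4).$$ Then the partial-dual Euler genus polynomial of $C_{2n+2}$ is $${}^{\partial}\varepsilon_{C_{2n+2}}(z)=2^{n+1}(n+2)z^{2n+2}+\sum_{s=2}^{n}2^{n+1}\left(\binom{n}{s}+\binom{n}{s-1}\right)z^{2n-2s+4}+2^{n+1}z^{2}.$$
   Context: A ribbon graph $G$ is a (possibly non-orientable) surface with boundary given as the union of vertex-discs $V(G)$ and edge-ribbons (discs) $E(G)$, where vertex-discs are pairwise disjoint, ribbons are pairwise disjoint, and each ribbon meets the vertex-discs in exactly two disjoint arcs (its ends, or half-edges), each lying on the boundary of exactly one vertex-disc. For a connected ribbon graph $G$ with $v$ vertices, $e$ edges and $f$ boundary components, the Euler genus $\varepsilon(G)$ is defined by $v-e+f=2-\varepsilon(G)$. For $A\subseteq E(G)$, the partial dual $G^A$ is the ribbon graph obtained by gluing a disc along each boundary component of the spanning ribbon subgraph $(V(G),A)$ (these discs are the vertices of $G^A$) and then removing the interiors of all original vertex-discs; its edges are the ribbons of $G$. The partial-dual Euler genus polynomial is ${}^{\partial}\varepsilon_G(z)=\sum_{A\subseteq E(G)}z^{\varepsilon(G^A)}$. A bouquet is a ribbon graph with exactly one vertex. A signed rotation of a bouquet is the cyclic ordering of the half-edges around the vertex, each half-edge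 being written as the label of its edge together with a sign: the two half-edges of an edge get the same sign $+$ if the edge is an untwisted loop, and different signs (one $+$, one $-$) if it is a twisted loop. The sign $+$ is omitted. The signed rotation determines the bouquet. In the signed rotation of $C_{2n+2}$, after the entries $-2,-1$ the pairs $2i+1,2i+2$ occur in decreasing order of $i$, from $i=n$ to $i=1$, with $2i+1$ immediately followed by $2i+2$ in each pair. Thus edges $1,2$ are twisted and all other edges are untwisted. For $n=1$ the sum over $s$ from $2$ to $n$ is empty. *)

(* Defs.v *)
From HB Require Import structures.
From mathcomp Require Import all_boot all_order all_algebra.

Set Implicit Arguments.
Unset Strict Implicit.
Unset Printing Implicit Defensive.

(* A ribbon is a rectangle: two opposite sides are its ends (the arcs glued to
   vertex-discs), the other two are free and lie on the boundary of the surface.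
   A ribbon graph with edge set E is encoded by the corners of its ribbons and
   three involutions: [rg_end x] is the other corner of the end at x,
   [rg_side x] is the other corner of the free side at x, and [rg_vert x] is the
   corner reached from x along the piece of vertex-disc boundary that joins the
   end at x to the next end. A vertex-disc is recovered from its boundary circle,
   along which [rg_end] and [rg_vert] steps alternate.
   No orientation is chosen, so the surface may be non-orientable. Every
   vertex-disc of an encoded ribbon graph meets at least one ribbon, which
   excludes only isolated vertices. *)
Record ribbon_graph (E : finType) := RibbonGraph {
  corner : finType;
  rg_edge : corner -> E;
  rg_end : corner -> corner;
  rg_side : corner -> corner;
  rg_vert : corner -> corner;
  rg_endK : involutive rg_end;
  rg_sideK : involutive rg_side;
  rg_vertK : involutive rg_vert;
  rg_end_neq : forall x, rg_end x != x;
  rg_side_neq : forall x, rg_side x != x;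
  rg_vert_neq : forall x, rg_vert x != x;
  rg_end_side_neq : forall x, rg_end x != rg_side x;
  rg_end_sideC : forall x, rg_end (rg_side x) = rg_side (rg_end x);
  rg_edge_end : forall x, rg_edge (rg_end x) = rg_edge x;
  rg_edge_side : forall x, rg_edge (rg_side x) = rg_edge x;
  rg_edge_card : forall e, #|[set x | rg_edge x == e]| = 4
}.

Section RibbonGraphTheory.
Variables (E : finType) (G : ribbon_graph E).

(* The boundary of the spanning ribbon subgraph (V(G), A) follows the free sides
   of the ribbons in A, and runs over the former ends of the others. *)
Definition across (A : {set E}) (x : corner G) : corner G :=
  if rg_edge x \in A then rg_side x else rg_end x.

Definition boundary_step (A : {set E}) : rel (corner G) :=
  [rel x y | (rg_vert x == y) || (across A x == y)].

(* the number of boundary components of (V(G), A) *)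
Definition nboundary (A : {set E}) : nat := n_comp (boundary_step A) predT.

(* each vertex-disc of G is bounded by one boundary circle of (V(G), set0) *)
Definition nvertices : nat := nboundary set0.
Definition nfaces : nat := nboundary [set: E].

Lemma edge_across A x : rg_edge (across A x) = rg_edge x.
Proof. by rewrite /across; case: ifP; rewrite (rg_edge_side, rg_edge_end). Qed.

Lemma acrossK A : involutive (across A).
Proof.
move=> x; rewrite {1}/across edge_across /across.
by case: ifP => eA; rewrite eA; [exact: rg_sideK | exact: rg_endK].
Qed.

Lemma across_neq A x : across A x != x.
Proof. by rewrite /across; case: ifP; rewrite (rg_side_neq, rg_end_neq). Qed.

Lemma across_neqC A x : across A x != across (~: A) x.
Proof.
by rewrite /across inE; case: ifP => _ /=; rewrite ?[_ == rg_end _]eq_sym rg_end_side_neq.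
Qed.

Lemma across_comm A x : across A (across (~: A) x) = across (~: A) (across A x).
Proof.
rewrite /across !inE; case: (boolP (rg_edge x \in A)) => eA /=;
  by rewrite ?rg_edge_side ?rg_edge_end ?(negPf eA) ?eA rg_end_sideC.
Qed.

(* The partial dual G^A. Its vertex-discs are glued along the boundary
   components of (V(G), A), so a ribbon in A is now attached along its former
   free sides and its former ends become free; a ribbon outside A keeps its ends.
   The boundary pieces between consecutive ribbons are unchanged. *)
Definition partial_dual (A : {set E}) : ribbon_graph E :=
  @RibbonGraph E (corner G) (@rg_edge _ G) (across A) (across (~: A))
    (@rg_vert _ G) (acrossK A) (acrossK (~: A)) (@rg_vertK _ G)
    (across_neq A) (across_neq (~: A)) (@rg_vert_neq _ G)
    (across_neqC A) (across_comm A) (edge_across A) (edge_across (~: A))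
    (@rg_edge_card _ G).

(* The Euler genus of a connected ribbon graph. *)
Definition euler_genus : int :=
  (2 - ((nvertices : int) - (#|E| : int) + (nfaces : int)))%R.

End RibbonGraphTheory.

Lemma nvertices_partial_dual (E : finType) (G : ribbon_graph E) (A : {set E}) :
  nvertices (partial_dual G A) = nboundary G A.
Proof.
apply: eq_n_comp; apply: eq_connect => x y.
by rewrite /boundary_step /= [in LHS]/across in_set0.
Qed.

(* The exponent is an absolute value only to be a natural number: the Euler
   genus of a connected ribbon graph is nonnegative, and a partial dual of a
   connected ribbon graph is connected. *)
Definition partial_dual_genus_poly (E : finType) (G : ribbon_graph E) :
    {poly int} :=
  (\sum_(A : {set E}) 'X^(absz (euler_genus (partial_dual G A))))%R.

(* The half-edges met around the vertex, read cyclically; an entry is a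
   sign (true for -) and the label of an edge. *)
Definition signed_rotation (E : finType) := seq (bool * E).

Definition valid_rotation (E : finType) (w : signed_rotation E) : Prop :=
  forall e : E, count (fun x => x.2 == e) w = 2.

Section Bouquet.
Variables (E : finType) (w : signed_rotation E).
Hypothesis w_valid : valid_rotation w.

Local Notation pos := 'I_(size w).

Definition half_edge_label (i : pos) : E := (tnth (in_tuple w) i).2.
Definition half_edge_sign (i : pos) : bool := (tnth (in_tuple w) i).1.

(* the position of the other half-edge of the same edge *)
Definition mate (i : pos) : pos :=
  odflt i [pick j | (j != i) && (half_edge_label j == half_edge_label i)].

Lemma card_label e : #|[set i : pos | half_edge_label i == e]| = 2.
Proof.
rewrite -(w_valid e) cardsE cardE /enum_mem size_filter.
rewrite -[w in RHS](map_tnth_enum (in_tuple w)) [RHS]count_map enumT.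
exact: eq_count.
Qed.

Lemma mate_unique i j : j != i -> half_edge_label j = half_edge_label i ->
  j = mate i.
Proof.
move=> ji eji; rewrite /mate; case: pickP => [k /andP[ki /eqP eki]|/(_ j)] /=; last first.
  by rewrite ji eji eqxx.
apply/eqP/negPn/negP => jk.
have : #|[set i; j; k]| <= 2.
  rewrite -(card_label (half_edge_label i)); apply: subset_leq_card.
  by apply/subsetP => l; rewrite !inE => /orP[/orP[]|] /eqP ->; rewrite ?eji ?eki.
by rewrite setUC cardsU1 cards2 !inE (negPf ki) [k == j]eq_sym (negPf jk) [i == j]eq_sym ji.
Qed.

Lemma mate_ex i : exists2 j, j != i & half_edge_label j = half_edge_label i.
Proof.
have := card_label (half_edge_label i).
rewrite (cardsD1 i) inE eqxx /= => /eqP; rewrite eqSS => /cards1P[j /setP/(_ j)].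
by rewrite !inE eqxx => /andP[ji /eqP eji]; exists j.
Qed.

Lemma mate_neq i : mate i != i.
Proof. by have [j ji eji] := mate_ex i; rewrite -(mate_unique ji eji). Qed.

Lemma label_mate i : half_edge_label (mate i) = half_edge_label i.
Proof. by have [j ji eji] := mate_ex i; rewrite -(mate_unique ji eji). Qed.

Lemma mateK : involutive mate.
Proof.
by move=> i; apply/esym/mate_unique; rewrite ?label_mate // eq_sym mate_neq.
Qed.

(* The corner (i, b) is the first (b = false) or last (b = true) point of the
   arc of half-edge i, the vertex-disc being traversed in the order of w. *)
Let C := (pos * bool)%type.

Definition bq_edge (x : C) : E := half_edge_label x.1.
Definition bq_end (x : C) : C := (x.1, ~~ x.2).
Definition bq_vert (x : C) : C :=
  if x.2 then (ordS x.1, false) else (ord_pred x.1, true).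

(* The free sides of an untwisted ribbon (equal signs) join the first point of
   each end to the last point of the other; those of a twisted ribbon join first
   to first and last to last. *)
Definition bq_side (x : C) : C :=
  (mate x.1, x.2 (+) (half_edge_sign x.1 == half_edge_sign (mate x.1))).

Lemma bq_endK : involutive bq_end.
Proof. by case=> i b; rewrite /bq_end /= negbK. Qed.

Lemma bq_sideK : involutive bq_side.
Proof.
by case=> i b; rewrite /bq_side /= mateK [half_edge_sign (mate i) == _]eq_sym addbK.
Qed.

Lemma bq_vertK : involutive bq_vert.
Proof. by case=> i [] /=; rewrite /bq_vert /= ?ordSK ?ord_predK. Qed.

Lemma bq_end_neq x : bq_end x != x.
Proof. by case: x => i []; rewrite /bq_end xpair_eqE andbF. Qed.

Lemma bq_side_neq x : bq_side x != x.
Proof. by case: x => i b; rewrite /bq_side xpair_eqE (negPf (mate_neq i)). Qed.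

Lemma bq_vert_neq x : bq_vert x != x.
Proof. by case: x => i []; rewrite /bq_vert xpair_eqE andbF. Qed.

Lemma bq_end_side_neq x : bq_end x != bq_side x.
Proof.
by case: x => i b; rewrite /bq_end /bq_side xpair_eqE eq_sym (negPf (mate_neq i)).
Qed.

Lemma bq_end_sideC x : bq_end (bq_side x) = bq_side (bq_end x).
Proof. by case: x => i b; rewrite /bq_end /bq_side /= addNb. Qed.

Lemma bq_edge_end x : bq_edge (bq_end x) = bq_edge x.
Proof. by []. Qed.

Lemma bq_edge_side x : bq_edge (bq_side x) = bq_edge x.
Proof. exact: label_mate. Qed.

Lemma bq_edge_card e : #|[set x | bq_edge x == e]| = 4.
Proof.
have -> : [set x | bq_edge x == e] =
    setX [set i | half_edge_label i == e] [set: bool].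
  by apply/setP => x; rewrite !inE andbT.
by rewrite cardsX card_label cardsT card_bool.
Qed.

Definition bouquet : ribbon_graph E :=
  RibbonGraph bq_endK bq_sideK bq_vertK bq_end_neq bq_side_neq bq_vert_neq
    bq_end_side_neq bq_end_sideC bq_edge_end bq_edge_side bq_edge_card.

Lemma nvertices_bouquet : 0 < size w -> nvertices bouquet = 1.
Proof.
move=> w_gt0; pose r := boundary_step (G := bouquet) set0.
have rE x y : r x y = (bq_vert x == y) || (bq_end x == y).
  by rewrite /r /boundary_step /= /across in_set0.
have r_sym : symmetric r.
  have flip (f : C -> C) x y : involutive f -> (f x == y) = (f y == x).
    by move=> fK; rewrite (inv_eq fK) eq_sym.
  by move=> x y; rewrite !rE (flip _ _ _ bq_vertK) (flip _ _ _ bq_endK).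
have c_sym : connect_sym r by apply: sym_connect_sym.
pose x0 : C := (Ordinal w_gt0, false).
rewrite -(n_comp_connect c_sym x0); apply: eq_n_comp_r => -[i b] /=.
rewrite inE; apply/esym.
suff conn k (kw : k < size w) : connect r x0 (Ordinal kw, false).
  have c0 : connect r x0 (i, false) by case: (i) => k kw; exact: conn.
  case: b => //; apply: connect_trans c0 (connect1 _).
  by rewrite rE orbC eqxx.
elim: k kw => [|k IHk] kw; first by rewrite (bool_irrelevance kw w_gt0) connect0.
apply: connect_trans (IHk (ltnW kw)) _.
apply: (@connect_trans _ _ (Ordinal (ltnW kw), true)); apply: connect1.
  by rewrite rE orbC eqxx.
rewrite rE; apply/orP; left; rewrite /bq_vert /= xpair_eqE eqxx andbT.
by apply/eqP/val_inj; rewrite /= modn_small.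
Qed.

End Bouquet.

(* The edges 1, ..., 2n+2 are represented by the ordinals 0, ..., 2n+1; the
   nonzero integer x stands for a half-edge of edge |x|, with the sign of x. *)
Definition entry (n : nat) (x : int) : bool * 'I_(2 * n).+2 :=
  ((x < 0)%R, inord (absz x).-1).

Definition C_word (n : nat) : seq int :=
  [seq Posz k | k <- iota 1 (2 * n + 2)] ++ [:: (-2)%R; (-1)%R] ++
  flatten [seq [:: Posz (2 * i + 1); Posz (2 * i + 2)] | i <- rev (iota 1 n)].

Definition C_rotation (n : nat) : signed_rotation 'I_(2 * n).+2 :=
  [seq entry n x | x <- C_word n].

Lemma C_word_perm n :
  perm_eq [seq absz x | x <- C_word n] (iota 1 (2 * n).+2 ++ iota 1 (2 * n).+2).
Proof.
have pairs m : perm_eq (flatten [seq [:: 2 * i + 1; 2 * i + 2] | i <- rev (iota 1 m)])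
    (iota 3 (2 * m)).
  have -> : iota 3 (2 * m) = flatten [seq [:: 2 * i + 1; 2 * i + 2] | i <- iota 1 m].
    elim: m => // m IHm.
    rewrite mulnSr iotaD IHm -[m.+1]addn1 iotaD map_cat flatten_cat /=.
    by congr (_ ++ [:: _; _]); rewrite mulnDr addnAC.
  by apply/perm_flatten/perm_map; rewrite perm_rev.
rewrite /C_word !map_cat -map_comp map_id addn2 perm_cat2l map_flatten -map_comp.
rewrite (_ : iota 1 (2 * n).+2 = [:: 1; 2] ++ iota 3 (2 * n)) //.
apply: perm_cat; first exact: (perm_catC [:: 2] [:: 1]).
rewrite (eq_map (g := fun i => [:: 2 * i + 1; 2 * i + 2])) ?pairs //.
Qed.

Lemma C_rotation_valid n : valid_rotation (C_rotation n).
Proof.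
move=> e; rewrite /C_rotation count_map.
rewrite (@eq_count _ _ (preim absz (fun k => inord k.-1 == e))) // -count_map.
have /permP -> := C_word_perm n.
suff cnt1 : count (fun k => inord k.-1 == e) (iota 1 (2 * n).+2) = 1.
  by rewrite count_cat cnt1.
rewrite -[1%N]/(1 + 0)%N iotaDl count_map.
rewrite (@eq_in_count _ _ (pred1 (e : nat))) => [|k].
  by rewrite count_uniq_mem ?iota_uniq // mem_iota ltn_ord.
by rewrite mem_iota add0n => /= k_lt; rewrite -val_eqE /= inordK.
Qed.

Definition C_bouquet (n : nat) : ribbon_graph 'I_(2 * n).+2 :=
  bouquet (@C_rotation_valid n).

(* Main.v *)
Require Import Defs.
From mathcomp Require Import all_boot all_order all_algebra.
From mathcomp Require Import zify.
Import GRing.Theory.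

(** Write [f A] for the number of boundary components of the spanning subgraph
    with ribbon set [A]. The vertices of the partial dual are the boundary
    components for [A], its faces those for the complement, so its Euler genus is
    [2n + 4 - f A - f (~: A)], and everything reduces to computing [f].

    Cut the boundary of the vertex-disc at its half-edges. The 4n+4 arcs that
    remain, here called gaps, are joined to one another along the ribbons, and
    [f A] counts the circles so formed. The word of the bouquet reads the pairs
    (3,4), (5,6), ... forwards and then, past the entries -2, -1, backwards.
    Hence the gaps between consecutive pairs form a ladder: rail points [lower k]
    on the first passage face rail points [upper k] on the second, for k = 0..n.
    The k-th pair acts as follows.
    - When both or neither of its edges are in [A], it continues the two rails:
      [lower k] to [lower k.+1] and [upper k] to [upper k.+1].
    - When exactly one is in [A] (a mixed pair), it turns the rails back:
      [lower k] is joined to [upper k], and [lower k.+1] to [upper k.+1].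
    The edges 1, 2 close the ladder: when both or neither are in [A], [lower]
    meets [upper] at each end; otherwise [lower 0] is joined to [upper n], and
    [lower n] to [upper 0], which makes the ladder a Moebius band.

    So with [d] mixed pairs the ladder is cut into [d + 1] pieces, each of which
    is a circle in the first case; in the second the two extreme pieces form one
    circle, leaving [max d 1]. This is [nboundary_C]. Neither [d] nor the case
    changes when [A] is complemented, so the genus is [2n + 4 - 2 f A], and
    each case occurs with [d] mixed pairs for [2 ^ (n + 1) 'C(n, d)] sets [A]
    ([sum_over_profiles]). *)

Set Implicit Arguments.
Unset Strict Implicit.
Unset Printing Implicit Defensive.

(** * Counting boundary components by labelling gaps *)

(** The connected components are the fibres of [h]: [h] maps the canonical
    representatives bijectively onto ['I_K]. *)
Lemma n_comp_labelling (T : finType) (e : rel T) (K : nat) (h : T -> 'I_K) :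
  connect_sym e ->
  (forall x y, e x y -> h x = h y) ->
  (forall x y, h x = h y -> connect e x y) ->
  (forall j, exists x, h x = j) ->
  n_comp e predT = K.
Proof.
move=> sym_e h_step h_conn h_surj.
have h_connect x y : connect e x y -> h x = h y.
  by case/connectP=> p + ->; elim: p x => //= z p IHp x /andP[/h_step -> /IHp].
transitivity #|roots e|; first by apply: eq_card => x; rewrite !inE andbT.
rewrite -(card_in_imset (f := h)).
  rewrite -[RHS]card_ord -cardsT; apply: eq_card => j; rewrite inE.
  have [x <-] := h_surj j; apply/imsetP; exists (fingraph.root e x).
    exact: roots_root.
  exact/h_connect/connect_root.
move=> x y /eqP rx /eqP ry /h_conn; rewrite -{2}rx -{2}ry.
by move=> /(fingraph.rootP sym_e).
Qed.

(** How a ribbon joins the gaps next to its two ends, when [p], [p'] are the gaps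
    before and after one end and [q], [q'] those of the other. A missing ribbon
    lets the boundary run over its ends; along an untwisted one the direction
    around the vertex is kept, along a twisted one it is reversed. *)
Definition edge_glue (R : nat -> nat -> Prop) (inA tw : bool) (p p' q q' : nat) : Prop :=
  if inA then
    if tw then R p q /\ R p' q' else R p q' /\ R p' q
  else R p p' /\ R q q'.

Definition has_ends (E : eqType) (w : seq (bool * E)) (e : E) tw p q : Prop :=
  exists s, [/\ p < size w, q < size w, p != q,
    nth (false, e) w p = (s, e) & nth (false, e) w q = (s (+) tw, e)].

Section BouquetGaps.
Variables (E : finType) (w : signed_rotation E).
Hypotheses (w_valid : valid_rotation w) (w_gt0 : 0 < size w).
Variable A : {set E}.

Local Notation G := (bouquet w_valid).
Local Notation step := (boundary_step (G := G) A).

Definition position (p : nat) : 'I_(size w) := Ordinal (ltn_pmod p w_gt0).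

(** The gap before position [p], represented by the corner at its end. Positions
    are taken modulo the length of the word, as the vertex is a circle. *)
Definition gap (p : nat) : corner G := (position p, false).

Lemma position_val (i : 'I_(size w)) : position i = i.
Proof. by apply: val_inj; rewrite /= modn_small. Qed.

Lemma boundary_step_sym : symmetric step.
Proof.
have flip (f : corner G -> corner G) x y : involutive f -> (f x == y) = (f y == x).
  by move=> fK; rewrite (inv_eq fK) eq_sym.
move=> x y; rewrite /boundary_step /= (flip _ _ _ (@bq_vertK _ w)).
by rewrite (flip _ _ _ (@acrossK _ G A)).
Qed.

Lemma connect_step_sym : connect_sym step.
Proof. exact/sym_connect_sym/boundary_step_sym. Qed.

Lemma vert_last (i : 'I_(size w)) : bq_vert (i, true) = gap i.+1.
Proof. by congr pair; apply: val_inj. Qed.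

Lemma connect_last p : connect step (position p, true) (gap p.+1).
Proof.
apply: connect1; rewrite /boundary_step /= vert_last /gap.
by rewrite (_ : position _.+1 = position p.+1) ?eqxx //; apply: val_inj; rewrite /= -addn1 modnDml addn1.
Qed.

Lemma connect_across x y : across A x = y -> connect step x y.
Proof. by move=> xy; apply: connect1; rewrite /boundary_step /= xy eqxx orbT. Qed.

Section Ends.
Variables (e : E) (tw : bool) (p q : nat).
Hypothesis ends_e : has_ends w e tw p q.

Lemma label_ends :
  (half_edge_label (position p) = e) * (half_edge_label (position q) = e).
Proof.
have [s [pw qw _ wp wq]] := ends_e.
rewrite /half_edge_label !(tnth_nth (false, e)) /= !modn_small //.
by rewrite wp wq.
Qed.

Lemma mate_ends :
  (mate (position p) = position q) * (mate (position q) = position p).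
Proof.
have [lp lq] := label_ends; have [s [pw qw npq _ _]] := ends_e.
have nPQ : position q != position p.
  by rewrite -val_eqE /= !modn_small // eq_sym.
split; apply/esym/(mate_unique w_valid); rewrite ?lp ?lq //.
by rewrite eq_sym.
Qed.

Lemma sign_ends :
  (half_edge_sign (position p) == half_edge_sign (position q)) = ~~ tw.
Proof.
have [s [pw qw _ wp wq]] := ends_e.
rewrite /half_edge_sign !(tnth_nth (false, e)) /= !modn_small //.
by rewrite wp wq /=; case: (s); case: (tw).
Qed.

Lemma across_ends b :
  (across A ((position p, b) : corner G) =
    if e \in A then (position q, b (+) ~~ tw) else (position p, ~~ b)) *
  (across A ((position q, b) : corner G) =
    if e \in A then (position p, b (+) ~~ tw) else (position q, ~~ b)).
Proof.
rewrite /across /= /bq_edge /= !label_ends /bq_side /bq_end /= !mate_ends.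
by rewrite [half_edge_sign (position q) == _]eq_sym sign_ends.
Qed.

(** Each free side of a ribbon in [A], or each end of another ribbon, is a single
    step between corners; moving from a corner to the representative of its gap
    turns this into a relation between gaps. *)
Lemma connect_ends :
  edge_glue (fun i j => connect step (gap i) (gap j)) (e \in A) tw p p.+1 q q.+1.
Proof.
pose conn := connect step.
have last_gap i : conn (position i, true) (gap i.+1) by exact: connect_last.
have gap_last i : conn (gap i.+1) (position i, true).
  by rewrite /conn connect_step_sym.
have ac x y : across A x = y -> conn x y by exact: connect_across.
rewrite /edge_glue; case: ifP => eA; [case: ifP => twE|]; split.
- by apply: ac; rewrite across_ends eA twE.
- apply: connect_trans (gap_last p) _; apply: connect_trans (last_gap q).
  by apply: ac; rewrite across_ends eA twE.
- apply: connect_trans (last_gap q).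
  by apply: ac; rewrite across_ends eA twE.
- apply: connect_trans (gap_last p) _.
  by apply: ac; rewrite across_ends eA twE.
- apply: connect_trans (last_gap p).
  by apply: ac; rewrite across_ends eA.
- apply: connect_trans (last_gap q).
  by apply: ac; rewrite across_ends eA.
Qed.

End Ends.

(** A labelling of the gaps extends to corners through the gap at each corner, and
    is then constant along the boundary as soon as it respects every ribbon. The
    condition [h (size w) = h 0] makes it well defined around the vertex. *)
Lemma nboundary_gap_labelling (K : nat) (h : nat -> nat) :
  (forall q, h q < K) ->
  h (size w) = h 0 ->
  (forall e, exists tw p q, has_ends w e tw p q /\
     edge_glue (fun i j => h i = h j) (e \in A) tw p p.+1 q q.+1) ->
  (forall p q, p < size w -> q < size w -> h p = h q ->
     connect step (gap p) (gap q)) ->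
  (forall j, j < K -> exists2 q, q < size w & h q = j) ->
  nboundary G A = K.
Proof.
move=> hK h_wrap h_glue h_conn h_surj.
pose H (x : corner G) : 'I_K := Ordinal (hK (x.1 + x.2)).
have H_gap p : p < size w -> val (H (gap p)) = h p.
  by move=> pw; rewrite /= modn_small // addn0.
have H_vert x : H (bq_vert x) = H x.
  have vert_true i : H (bq_vert (i, true)) = H (i, true).
    apply: val_inj; rewrite /= addn0 addn1.
    have [-> |] := eqVneq i.+1 (size w); first by rewrite modnn h_wrap.
    by move=> ne; rewrite modn_small //; have := ltn_ord i; lia.
  case: x => i [] //; rewrite -[in RHS](bq_vertK (i, false)).
  by rewrite [X in _ = H (bq_vert X)]/bq_vert vert_true.
have H_across x : H (across A x) = H x.
  have [e xe] : exists e, half_edge_label x.1 = e by exists (half_edge_label x.1).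
  have [tw [p [q [ends_e glue_e]]]] := h_glue e.
  have [s [pw qw npq wp wq]] := ends_e.
  have x1 : (x.1 = position p) \/ (x.1 = position q).
    have [|ne] := eqVneq x.1 (position p); first by left.
    right; rewrite -(mate_ends ends_e).1; apply: (mate_unique w_valid ne).
    by rewrite (label_ends ends_e).
  case: x x1 {xe} => i b /= x1.
  move: glue_e; rewrite /edge_glue => glue_e; apply: val_inj => /=.
  by case: x1 glue_e => ->; rewrite (across_ends ends_e);
    case: ifP => _; try case: (tw); case: (b) => /= -[h1 h2];
    rewrite !modn_small // ?addn1 ?addn0 // ?h1 ?h2.
have gap_conn x : connect step x (gap (x.1 + x.2)).
  case: x => i []; rewrite ?addn0.
    by rewrite /= addn1 -{1}[i]position_val; exact: connect_last.
  by rewrite /gap position_val.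
apply: (n_comp_labelling (h := H)); first exact: connect_step_sym.
- by move=> x y /orP[] /eqP <-; [apply/esym/H_vert | apply/esym/H_across].
- have mod_gap (x : corner G) : gap (x.1 + x.2) = gap ((x.1 + x.2) %% size w).
    by congr pair; apply: val_inj; rewrite /= modn_mod.
  have h_mod (x : corner G) : h ((x.1 + x.2) %% size w) = H x.
    rewrite /H /=; case: x => i b /=.
    have [-> |ne] := eqVneq (i + b) (size w); first by rewrite modnn h_wrap.
    by rewrite modn_small //; have := ltn_ord i; case: (b) ne => /=; lia.
  move=> x y hxy; apply: connect_trans (gap_conn x) _.
  rewrite connect_step_sym; apply: connect_trans (gap_conn y) _.
  rewrite !mod_gap; apply: h_conn; rewrite ?ltn_pmod //.
  by rewrite !h_mod hxy.
move=> j; have [q qw hq] := h_surj j (ltn_ord j).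
by exists (gap q); apply: val_inj; rewrite H_gap.
Qed.

End BouquetGaps.

(** * The ladder of gaps

    Edges are numbered from 0, and [bit e] tells whether edge [e] is kept, so the
    k-th pair consists of the edges [2k+2] and [2k+3]. *)
Section Ladder.
Variables (n : nat) (bit : nat -> bool).

Definition mixed k := bit (2 * k + 2) (+) bit (2 * k + 3).
Definition nmixed i := \sum_(0 <= k < i) mixed k.

Lemma nmixedS i : nmixed i.+1 = nmixed i + mixed i.
Proof. by rewrite /nmixed big_nat_recr. Qed.

Lemma nmixed0 : nmixed 0 = 0.
Proof. by rewrite /nmixed big_geq. Qed.

Lemma leq_nmixed i j : i <= j -> nmixed i <= nmixed j.
Proof.
elim: j => [|j IHj]; first by case: i.
by rewrite leq_eqVlt ltnS => /predU1P[-> //|/IHj]; rewrite nmixedS; lia.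
Qed.

(** A discrete intermediate value argument: [nmixed] grows by at most 1. *)
Lemma nmixed_attained d : d <= nmixed n -> exists2 i, i <= n & nmixed i = d.
Proof.
elim: n => [|m IHm]; first by rewrite nmixed0 leqn0 => /eqP ->; exists 0; rewrite ?nmixed0.
have [/IHm[i im <-] _|lt_d le_d] := leqP d (nmixed m); first by exists i => //; lia.
exists m.+1 => //; move: le_d; rewrite nmixedS; case: (mixed m) => /=; lia.
Qed.

(** Gaps are named by the position that they precede. The gap [lower_mid k] lies
    inside the first occurrence of the k-th pair and [upper_mid k] inside the
    second; the gap [1] separates the entries 1, 2 and [far_mid] the entries -2,
    -1. As the vertex is a circle, [upper 0 = 4n+4] is the gap [0]. *)
Definition lower k := 2 * k + 2.
Definition upper k := 4 * n + 4 - 2 * k.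
Definition lower_mid k := 2 * k + 3.
Definition upper_mid k := 4 * n + 3 - 2 * k.
Definition far_mid := 2 * n + 3.

(** [R] contains all the joins. The arguments are read off the word: the edges 0
    and 1 recur in the opposite order, the two edges of a pair in the same order,
    and later pairs recur earlier. *)
Definition C_glued (R : nat -> nat -> Prop) : Prop :=
  [/\ edge_glue R (bit 0) true 0 1 far_mid (upper n),
      edge_glue R (bit 1) true 1 (lower 0) (lower n) far_mid,
      forall k, k < n -> edge_glue R (bit (2 * k + 2)) false
        (lower k) (lower_mid k) (upper k.+1) (upper_mid k) &
      forall k, k < n -> edge_glue R (bit (2 * k + 3)) false
        (lower_mid k) (lower k.+1) (upper_mid k) (upper k)].

(** The claimed number of boundary components. When only one of the edges 0, 1 is
    kept, the first and last pieces of the ladder merge; without mixed pairs they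
    are the same piece, hence the maximum with 1. *)
Definition ncircles := if bit 0 == bit 1 then (nmixed n).+1 else maxn (nmixed n) 1.

(** The index of a rail point on the same circle as [q]. The gaps that are not on
    the rails take the level of the rail point to which edge 0, or the even edge
    of their pair, joins them. *)
Definition level q :=
  if odd q then
    if q == 1 then if bit 0 then n else 0
    else if q == 2 * n + 3 then if bit 0 then 0 else n
    else if q < 2 * n + 3 then let k := q./2.-1 in k + bit (2 * k + 2)
    else let k := (4 * n + 3 - q)./2 in k + ~~ bit (2 * k + 2)
  else if q == 0 then 0 else if q <= 2 * n + 2 then q./2.-1 else (4 * n + 4 - q)./2.

(** The number of mixed pairs below tells the pieces of the ladder apart, and the
    reduction modulo [ncircles] identifies the two extreme pieces exactly when
    they merge. *)
Definition circle q := nmixed (level q) %% ncircles.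

Lemma level_lower k : k <= n -> level (lower k) = k.
Proof.
move=> kn; rewrite /level /lower ifF; last by lia.
rewrite ifF; last by lia.
by rewrite ifT; lia.
Qed.

Lemma level_upper k : k <= n -> level (upper k) = k.
Proof.
move=> kn; rewrite /level /upper ifF; last by lia.
rewrite ifF; last by lia.
by rewrite ifF; lia.
Qed.

Lemma level_lower_mid k : k < n -> level (lower_mid k) = k + bit (2 * k + 2).
Proof.
move=> kn; rewrite /level /lower_mid ifT; last by lia.
rewrite ifF; last by lia.
rewrite ifF; last by lia.
rewrite ifT; last by lia.
by rewrite (_ : (_./2).-1 = k) //; lia.
Qed.

Lemma level_upper_mid k : k < n -> level (upper_mid k) = k + ~~ bit (2 * k + 2).
Proof.
move=> kn; rewrite /level /upper_mid ifT; last by lia.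
rewrite ifF; last by lia.
rewrite ifF; last by lia.
rewrite ifF; last by lia.
by rewrite (_ : (_ - (_ - _))./2 = k) //; lia.
Qed.

Lemma level_1 : level 1 = if bit 0 then n else 0.
Proof. by []. Qed.

Lemma level_far_mid : level far_mid = if bit 0 then 0 else n.
Proof.
rewrite /level /far_mid ifT; last by lia.
by rewrite ifF ?eqxx //; lia.
Qed.

Lemma circle_ends : bit 0 != bit 1 -> nmixed n %% ncircles = nmixed 0 %% ncircles.
Proof.
rewrite /ncircles => /negPf ->; rewrite nmixed0 mod0n.
by case: (nmixed n) => [|d] //; rewrite (maxn_idPl _) // modnn.
Qed.

Lemma level_0 : level 0 = 0. Proof. by []. Qed.

Lemma gap_ind (P : nat -> Prop) :
  P 0 -> P 1 -> P far_mid ->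
  (forall k, k <= n -> P (lower k)) -> (forall k, k <= n -> P (upper k)) ->
  (forall k, k < n -> P (lower_mid k)) -> (forall k, k < n -> P (upper_mid k)) ->
  forall q, q < 4 * n + 4 -> P q.
Proof.
move=> P0 P1 Pf Pl Pu Plm Pum q qn.
have [->//|q0] := eqVneq q 0; have [->//|q1] := eqVneq q 1.
have [->//|qf] := eqVneq q far_mid.
rewrite /far_mid /lower /upper /lower_mid /upper_mid in Pl Pu Plm Pum qf.
have := odd_double_half q; case: (odd q) => /= qE.
  have [q_le|q_gt] := ltnP q (2 * n + 3).
    by rewrite (_ : q = 2 * q./2.-1 + 3); [apply: Plm|]; lia.
  by rewrite (_ : q = 4 * n + 3 - 2 * (2 * n + 1 - q./2)); [apply: Pum|]; lia.
have [q_le|q_gt] := leqP q (2 * n + 2).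
  by rewrite (_ : q = 2 * q./2.-1 + 2); [apply: Pl|]; lia.
by rewrite (_ : q = 4 * n + 4 - 2 * (2 * n + 2 - q./2)); [apply: Pu|]; lia.
Qed.

Lemma circle_glued : C_glued (fun i j => circle i = circle j).
Proof.
have ends := circle_ends.
rewrite /C_glued /edge_glue /circle level_0 level_1 level_far_mid.
rewrite !(level_lower, level_upper) //; split.
- by move: ends; case: (bit 0); case: (bit 1) => // /(_ isT) ->.
- by move: ends; case: (bit 0); case: (bit 1) => // /(_ isT) ->.
- move=> k kn; rewrite !(level_lower, level_upper, level_lower_mid, level_upper_mid) //; last exact: ltnW.
  by case: (bit _); rewrite ?addn0 ?addn1.
move=> k kn; rewrite !(level_lower, level_upper, level_lower_mid, level_upper_mid) //; last exact: ltnW.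
have := nmixedS k; rewrite /mixed.
by case: (bit (2 * k + 2)); case: (bit (2 * k + 3)) => /= E; rewrite ?addn0 ?addn1 ?E ?addn0.
Qed.

(** Conversely, in any equivalence [R] that contains all the joins, gaps with the
    same label are equivalent. *)
Section Connected.
Variable R : nat -> nat -> Prop.
Hypotheses (R_refl : forall p, R p p) (R_sym : forall p q, R p q -> R q p).
Hypothesis R_trans : forall p q r, R p q -> R q r -> R p r.
Hypotheses (R_glued : C_glued R) (R_wrap : R 0 (upper 0)).

Lemma unmixed_step k : k < n -> ~~ mixed k ->
  R (lower k) (lower k.+1) /\ R (upper k) (upper k.+1).
Proof.
case: R_glued => _ _ glue2 glue3 kn; rewrite /mixed.
move: (glue2 k kn) (glue3 k kn); rewrite /edge_glue.
by case: (bit _); case: (bit _) => //= -[h1 h2] [h3 h4] _; split; eauto.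
Qed.

Lemma mixed_step k : k < n -> mixed k ->
  R (lower k) (upper k) /\ R (lower k.+1) (upper k.+1).
Proof.
case: R_glued => _ _ glue2 glue3 kn; rewrite /mixed.
move: (glue2 k kn) (glue3 k kn); rewrite /edge_glue.
by case: (bit _); case: (bit _) => //= -[h1 h2] [h3 h4] _; split; eauto.
Qed.

Lemma end_step :
  if bit 0 == bit 1 then R (lower 0) (upper 0) /\ R (lower n) (upper n)
  else R (lower 0) (upper n) /\ R (lower n) (upper 0).
Proof.
case: R_glued => glue0 glue1 _ _; move: glue0 glue1; rewrite /edge_glue.
by case: (bit 0); case: (bit 1) => //= -[h1 h2] [h3 h4]; split; eauto.
Qed.

Lemma lower_connected i j :
  i <= j -> j <= n -> nmixed i = nmixed j -> R (lower i) (lower j).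
Proof.
elim: j => [|j IHj]; first by rewrite leqn0 => /eqP ->.
rewrite leq_eqVlt ltnS => /predU1P[-> //|ij] jn; rewrite nmixedS => eq_ij.
have le_ij := leq_nmixed ij; have Nj : ~~ mixed j by move: eq_ij; case: (mixed j); lia.
apply: R_trans (unmixed_step jn Nj).1; apply: IHj; rewrite ?(ltnW jn) //.
by move: eq_ij; rewrite (negPf Nj) addn0.
Qed.

(** Whether the two rails are connected at height [k] does not depend on [k]: a
    mixed pair connects them on both sides, any other pair transports the
    connection. *)
Lemma rung_all i : i <= n -> R (lower i) (upper i) ->
  forall j, j <= n -> R (lower j) (upper j).
Proof.
have step k : k < n -> R (lower k) (upper k) <-> R (lower k.+1) (upper k.+1).
  move=> kn; case Mk: (mixed k); first by have [? ?] := mixed_step kn Mk.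
  by have [h1 h2] := unmixed_step kn (negbT Mk); split; eauto.
have rung0 k : k <= n -> R (lower k) (upper k) <-> R (lower 0) (upper 0).
  elim: k => [//|k IHk] kn; rewrite -IHk ?(ltnW kn) //.
  by have [? ?] := step k kn; split.
by move=> i_n /(rung0 i i_n) R0 j jn; apply/rung0.
Qed.

(** One rung is enough, and there is always one: at the bottom when the ends of
    the ladder are closed up, next to any mixed pair otherwise, and without mixed
    pairs by following a whole rail across the twist. *)
Lemma rung i : i <= n -> R (lower i) (upper i).
Proof.
have := end_step; case: ifP => [_ [R0 _]|_ [R0n Rn0]]; first exact: rung_all R0 i.
have [d0 | d_gt0] := posnP (nmixed n).
  have R00 : R (lower 0) (upper 0).
    by apply: R_trans Rn0; apply: lower_connected; rewrite ?nmixed0.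
  exact: rung_all R00 i.
have [k kn Mk] : exists2 k, k < n & mixed k.
  move: d_gt0; rewrite /nmixed lt0n sum_nat_seq_neq0 => /hasP[k].
  by rewrite mem_index_iota /= => kn Mk; exists k => //; case: (mixed k) Mk.
exact: rung_all (ltnW kn) (mixed_step kn Mk).1 i.
Qed.

Lemma connected_to_level q : q < 4 * n + 4 -> R q (lower (level q)).
Proof.
have via_upper k p : k <= n -> R p (upper k) -> R p (lower k).
  by move=> kn Rp; apply: R_trans Rp _; apply/R_sym/rung.
have R0 : R 0 (lower 0) by apply: via_upper.
case: R_glued => glue0 _ glue2 _; move: glue0; rewrite /edge_glue => glue0.
move: q; apply: gap_ind => [||| k kn | k kn | k kn | k kn].
- by [].
- by rewrite level_1; case: (bit 0) glue0 => -[h1 h2]; eauto.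
- by rewrite level_far_mid; case: (bit 0) glue0 => -[h1 h2]; eauto.
- by rewrite level_lower.
- by rewrite level_upper //; apply/R_sym/rung.
- move: (glue2 k kn); rewrite level_lower_mid // /edge_glue.
  by case: (bit _) => -[h1 h2]; rewrite ?addn0 ?addn1; eauto.
move: (glue2 k kn); rewrite level_upper_mid // /edge_glue.
by case: (bit _) => -[h1 h2]; rewrite ?addn0 ?addn1; eauto.
Qed.

Lemma level_leq q : q < 4 * n + 4 -> level q <= n.
Proof.
move: q; apply: gap_ind => [||| k kn | k kn | k kn | k kn];
  rewrite ?level_0 ?level_1 ?level_far_mid ?level_lower ?level_upper
    ?level_lower_mid ?level_upper_mid //; case: (bit _) => //=; lia.
Qed.

Lemma circle_connected p q : p < 4 * n + 4 -> q < 4 * n + 4 ->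
  circle p = circle q -> R p q.
Proof.
move=> pn qn eq_pq.
apply: R_trans (connected_to_level pn) _; apply: R_sym.
apply: R_trans (connected_to_level qn) _.
have := level_leq pn; have := level_leq qn; move: eq_pq; rewrite /circle.
move: (level p) (level q) => i j {p q pn qn} eq_ij jn in_.
have eq_conn i' j' : i' <= n -> j' <= n -> nmixed i' = nmixed j' -> R (lower i') (lower j').
  move=> i'n j'n; case: (leqP i' j') => [le|/ltnW le] E; first exact: lower_connected.
  by apply/R_sym/lower_connected.
have [E|NE] := eqVneq (nmixed i) (nmixed j); first by apply: eq_conn.
have id := leq_nmixed in_; have jd := leq_nmixed jn.
move: eq_ij; rewrite /ncircles; have := end_step.
case: ifP => [_ _|_ [R0n Rn0]]; first by rewrite !modn_small // => E; rewrite E eqxx in NE.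
(* In the twisted case, distinct numbers of mixed pairs with equal labels must be
   the extreme values 0 and [nmixed n]. *)
have R_0n : R (lower 0) (lower n) by apply: R_trans R0n _; apply/R_sym/rung.
have ends k : nmixed k = 0 \/ nmixed k = nmixed n -> k <= n -> R (lower k) (lower n).
  by case=> E kn; [apply: R_trans R_0n; apply: eq_conn; rewrite ?nmixed0 | apply: eq_conn].
move=> eq_mod.
suff [Ei Ej] : (nmixed i = 0 \/ nmixed i = nmixed n) /\ (nmixed j = 0 \/ nmixed j = nmixed n).
  by apply: R_trans (ends j Ej jn) _; apply/R_sym/ends.
have [d_le1|d_gt1] := leqP (nmixed n) 1; first by split; lia.
rewrite (maxn_idPl _) in eq_mod; last exact: ltnW.
have small k : nmixed k <= nmixed n ->
    nmixed k %% nmixed n = if nmixed k == nmixed n then 0 else nmixed k.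
  by move=> le; case: eqVneq => [->|ne]; rewrite ?modnn // modn_small // ltn_neqAle ne.
move: eq_mod NE; rewrite !small //.
by do 2!case: eqVneq => [->|?]; try lia.
Qed.

End Connected.

Lemma ncircles_gt0 : 0 < ncircles.
Proof. by rewrite /ncircles; case: ifP => // _; rewrite leq_max orbT. Qed.

Lemma circle_lt q : circle q < ncircles.
Proof. by rewrite ltn_pmod ?ncircles_gt0. Qed.

Lemma circle_attained j : j < ncircles -> exists2 q, q < 4 * n + 4 & circle q = j.
Proof.
move=> jK; have [|i in_ Ei] := @nmixed_attained j.
  by move: jK; rewrite /ncircles; case: ifP => _; lia.
exists (lower i); first by rewrite /lower; lia.
by rewrite /circle level_lower // Ei modn_small.
Qed.

Lemma circle_wrap : circle (4 * n + 4) = circle 0.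
Proof.
by have := level_upper (leq0n n); rewrite /upper muln0 subn0 /circle level_0 => ->.
Qed.

End Ladder.

(** * The boundary components of the bouquet *)

Lemma nth_flatten_pairs (S T : Type) (f g : S -> T) (x0 : T) (y0 : S) s j c :
  j < size s ->
  nth x0 (flatten [seq [:: f i; g i] | i <- s]) (2 * j + (c : bool)) =
    if c then g (nth y0 s j) else f (nth y0 s j).
Proof.
elim: s j => // y s IHs [|j] js; first by case: (c).
by rewrite (_ : 2 * j.+1 + c = (2 * j + c).+2) /= ?IHs //; lia.
Qed.

Lemma size_C_word n : size (C_word n) = 4 * n + 4.
Proof.
have := perm_size (C_word_perm n); rewrite [in RHS]size_cat !size_iota size_map.
by move=> ->; lia.
Qed.

Lemma size_C_rotation n : size (C_rotation n) = 4 * n + 4.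
Proof. by rewrite -(size_C_word n); apply: size_map. Qed.

Lemma nth_C_rotation_first n z p : p < 2 * n + 2 ->
  nth z (C_rotation n) p = (false, inord p).
Proof.
move=> pn; rewrite /C_rotation (nth_map 0%R); last by rewrite size_C_word; lia.
rewrite /C_word nth_cat size_map size_iota pn (nth_map 0) ?size_iota //.
by rewrite nth_iota // /entry /= add0n.
Qed.

Lemma nth_C_rotation_twisted n z (c : bool) :
  nth z (C_rotation n) (2 * n + 2 + c) = (true, inord (1 - c)).
Proof.
rewrite /C_rotation (nth_map 0%R); last by rewrite size_C_word; lia.
rewrite /C_word nth_cat size_map size_iota ltnNge leq_addr /= addKn.
by case: c.
Qed.

Lemma nth_C_rotation_last n z k (c : bool) : k < n ->
  nth z (C_rotation n) (4 * n + 2 - 2 * k + c) = (false, inord (2 * k + 2 + c)).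
Proof.
move=> kn; rewrite /C_rotation (nth_map 0%R); last by rewrite size_C_word; lia.
rewrite /C_word nth_cat size_map size_iota ifF; last by lia.
rewrite nth_cat ifF; last by rewrite /=; lia.
rewrite (_ : _ - _ - _ = 2 * (n - k.+1) + c); last by rewrite /=; lia.
rewrite (nth_flatten_pairs (fun i => Posz (2 * i + 1)) _ _ 0); last first.
  by rewrite size_rev size_iota; lia.
rewrite nth_rev size_iota ?nth_iota; try lia.
by case: c; rewrite /entry /=; congr (_, inord _); lia.
Qed.

Section CBoundary.
Variables (n : nat) (A : {set 'I_(2 * n).+2}).

(** Indexing edges by naturals lets the ladder be studied without ordinals. *)
Definition bit_of (e : nat) : bool := inord e \in A.

Lemma C_has_ends :
  [/\ has_ends (C_rotation n) (inord 0) true 0 (far_mid n),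
      has_ends (C_rotation n) (inord 1) true 1 (lower n),
      forall k, k < n -> has_ends (C_rotation n) (inord (2 * k + 2)) false
        (lower k) (upper n k.+1) &
      forall k, k < n -> has_ends (C_rotation n) (inord (2 * k + 3)) false
        (lower_mid k) (upper_mid n k)].
Proof.
rewrite /lower /upper /lower_mid /upper_mid /far_mid.
have sz := size_C_rotation n.
split=> [||k kn|k kn]; exists false; split; rewrite ?sz; try lia;
  try by (rewrite nth_C_rotation_first //; lia).
- by rewrite (addnA _ 2 1) (@nth_C_rotation_twisted n _ true).
- by rewrite -[X in nth _ _ X]addn0 (@nth_C_rotation_twisted n _ false).
- rewrite (_ : _ - _ = 4 * n + 2 - 2 * k + false); last by lia.
  by rewrite nth_C_rotation_last ?addn0.
rewrite (_ : _ - _ = 4 * n + 2 - 2 * k + true); last by lia.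
by rewrite nth_C_rotation_last // -addnA.
Qed.

Lemma edge_cases (P : 'I_(2 * n).+2 -> Prop) :
  P (inord 0) -> P (inord 1) ->
  (forall k, k < n -> P (inord (2 * k + 2))) ->
  (forall k, k < n -> P (inord (2 * k + 3))) -> forall e, P e.
Proof.
move=> P0 P1 P2 P3 e; rewrite -(inord_val e); case: e => m /= mn.
case: m mn => [|[|m]] // mn; have := odd_double_half m; case: (odd m) => /= mE.
  by rewrite (_ : m.+2 = 2 * m./2 + 3); [apply: P3|]; lia.
by rewrite (_ : m.+2 = 2 * m./2 + 2); [apply: P2|]; lia.
Qed.

Lemma gap_succ k : k < n ->
  [/\ (lower k).+1 = lower_mid k, (upper n k.+1).+1 = upper_mid n k,
      (lower_mid k).+1 = lower k.+1 & (upper_mid n k).+1 = upper n k].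
Proof. by rewrite /lower /upper /lower_mid /upper_mid => kn; split; lia. Qed.

Lemma far_mid_succ : (far_mid n).+1 = upper n n /\ (lower n).+1 = far_mid n.
Proof. by rewrite /far_mid /upper /lower; split; lia. Qed.

Lemma nboundary_C : nboundary (C_bouquet n) A = ncircles n bit_of.
Proof.
have [ends0 ends1 ends2 ends3] := C_has_ends; have [fS lS] := far_mid_succ.
have w_gt0 : 0 < size (C_rotation n) by rewrite size_C_rotation; lia.
apply: (nboundary_gap_labelling (w_gt0 := w_gt0) (h := circle n bit_of)).
- exact: circle_lt.
- by rewrite size_C_rotation circle_wrap.
- have [g0 g1 g2 g3] := circle_glued n bit_of.
  apply: edge_cases => [||k kn|k kn].
  - by exists true, 0, (far_mid n); split=> //; rewrite fS.
  - by exists true, 1, (lower n); split=> //; rewrite lS.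
  - exists false, (lower k), (upper n k.+1); split; first exact: ends2.
    by have [-> -> _ _] := gap_succ kn; apply: g2.
  exists false, (lower_mid k), (upper_mid n k); split; first exact: ends3.
  by have [_ _ -> ->] := gap_succ kn; apply: g3.
- rewrite size_C_rotation => p q.
  pose G := C_bouquet n; pose g := gap (@C_rotation_valid n) w_gt0.
  apply: (circle_connected (R := fun i j => connect (boundary_step (G := G) A) (g i) (g j))).
  + by move=> i; apply: connect0.
  + by move=> i j; rewrite connect_step_sym.
  + by move=> i j k; apply: connect_trans.
  + split=> [||k kn|k kn].
    * by have := connect_ends (@C_rotation_valid n) w_gt0 A ends0; rewrite fS.
    * by have := connect_ends (@C_rotation_valid n) w_gt0 A ends1; rewrite lS.
    * have := connect_ends (@C_rotation_valid n) w_gt0 A (ends2 k kn).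
      by have [-> -> _ _] := gap_succ kn.
    have := connect_ends (@C_rotation_valid n) w_gt0 A (ends3 k kn).
    by have [_ _ -> ->] := gap_succ kn.
  rewrite (_ : g 0 = g (upper n 0)) ?connect0 //.
  congr pair; apply: val_inj; rewrite /= mod0n /upper muln0 subn0.
  by rewrite -size_C_rotation modnn.
by move=> j jK; rewrite size_C_rotation; apply: circle_attained.
Qed.

End CBoundary.

(** * The Euler genus of the partial duals *)

Lemma nfaces_partial_dual (E : finType) (G : ribbon_graph E) (A : {set E}) :
  nfaces (partial_dual G A) = nboundary G (~: A).
Proof.
apply: eq_n_comp; apply: eq_connect => x y.
by rewrite /boundary_step /= [in LHS]/across in_setT.
Qed.

Lemma bit_ofC n (A : {set 'I_(2 * n).+2}) e : bit_of (~: A) e = ~~ bit_of A e.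
Proof. by rewrite /bit_of inE. Qed.

Lemma ncirclesC n (A : {set 'I_(2 * n).+2}) :
  ncircles n (bit_of (~: A)) = ncircles n (bit_of A).
Proof.
rewrite /ncircles; have -> : nmixed (bit_of (~: A)) n = nmixed (bit_of A) n.
  by apply: eq_bigr => k _; rewrite /mixed !bit_ofC addbN addNb negbK.
by rewrite !bit_ofC (inj_eq negb_inj).
Qed.

(** This bound keeps the subtraction in the Euler genus from being truncated. *)
Lemma ncircles_leq n bit : 0 < n -> ncircles n bit <= n.+1.
Proof.
move=> n_gt0; suff : nmixed bit n <= n by rewrite /ncircles; case: ifP => _; lia.
by elim: n {n_gt0} => [|n IHn]; rewrite ?nmixed0 // nmixedS; case: (mixed _ _); lia.
Qed.

Lemma euler_genus_C n (A : {set 'I_(2 * n).+2}) : 0 < n ->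
  absz (euler_genus (partial_dual (C_bouquet n) A)) =
    2 * n + 4 - 2 * ncircles n (bit_of A).
Proof.
move=> n_gt0; rewrite /euler_genus nvertices_partial_dual nfaces_partial_dual.
rewrite !nboundary_C ncirclesC card_ord.
by have := ncircles_leq (bit_of A) n_gt0; lia.
Qed.

(** * Summation over the sets of edges *)

Section Profile.
Variable n : nat.

(** Recording which pairs are mixed instead of their second edges keeps all the
    information and makes the number of mixed pairs a cardinal. *)
Definition profile (A : {set 'I_(2 * n).+2}) :
    (bool * bool) * ({set 'I_n} * {set 'I_n}) :=
  ((bit_of A 0, bit_of A 1),
   ([set k : 'I_n | bit_of A (2 * k + 2)], [set k : 'I_n | mixed (bit_of A) k])).

Lemma profile_bij : bijective profile.
Proof.
apply: inj_card_bij => [A B|].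
  case=> e0 e1 /setP e2 /setP eM; apply/setP; apply: edge_cases => // k kn.
    by have := e2 (Ordinal kn); rewrite !inE.
  have := e2 (Ordinal kn); have := eM (Ordinal kn); rewrite !inE /mixed /= => + E.
  by rewrite E => /addbI.
rewrite !card_prod card_bool -!cardsT -!powersetT !card_powerset !cardsT !card_ord.
by rewrite -expnD (_ : (2 * n).+2 = (n + n) + 2) ?expnD 1?mulnC //; lia.
Qed.

Lemma nmixed_card A : nmixed (bit_of A) n = #|(profile A).2.2|.
Proof.
rewrite /nmixed big_mkord -sum1_card [RHS]big_mkcond /=.
by apply: eq_bigr => k _; rewrite inE; case: mixed.
Qed.

End Profile.

Lemma sum_powerset_by_card (V : zmodType) n (F : nat -> V) :
  (\sum_(D : {set 'I_n}) F #|D| = \sum_(0 <= d < n.+1) F d *+ 'C(n, d))%R.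
Proof.
rewrite big_mkord.
have cD (D : {set 'I_n}) : #|D| < n.+1.
  by rewrite ltnS -[X in _ <= X]card_ord max_card.
rewrite (partition_big (fun D => Ordinal (cD D)) xpredT) //=.
apply: eq_bigr => d _; rewrite (eq_bigr (fun=> F d)); last by move=> D /eqP <-.
rewrite sumr_const; congr (_ *+ _)%R.
by rewrite -[n in 'C(n, _)]card_ord -card_draws cardsE; apply: eq_card.
Qed.

(** The factor [2 ^ (n + 1)] collects what the summand ignores: the choice of edge
    0, and for each pair the choice of its first edge. *)
Lemma sum_over_profiles (V : zmodType) n (F : bool -> nat -> V) :
  (\sum_(A : {set 'I_(2 * n).+2})
     F (bit_of A 0 == bit_of A 1) (nmixed (bit_of A) n) =
   (\sum_(0 <= d < n.+1) (F true d + F false d) *+ 'C(n, d)) *+ 2 ^ (n + 1))%R.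
Proof.
pose G (y : (bool * bool) * ({set 'I_n} * {set 'I_n})) := F (y.1.1 == y.1.2) #|y.2.2|.
rewrite (eq_bigr (fun A => G (profile A))) => [|A _]; last by rewrite nmixed_card.
transitivity (\sum_y G y)%R.
  by apply/esym/(reindex (@profile n))/onW_bij/profile_bij.
rewrite -(pair_bigA _ (fun b s => G (b, s))) /=.
pose H b := (\sum_(0 <= d < n.+1) F b d *+ 'C(n, d))%R.
have inner b : (\sum_s G (b, s) = H (b.1 == b.2) *+ 2 ^ n)%R.
  rewrite -(pair_bigA _ (fun s t => G (b, (s, t)))) /=.
  rewrite /G /= sum_powerset_by_card sumr_const; congr (_ *+ _)%R.
  by rewrite -cardsT -powersetT card_powerset cardsT card_ord.
rewrite (eq_bigr _ (fun b _ => inner b)) -(pair_bigA _ (fun b c => H (b == c) *+ 2 ^ n)%R) /=.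
rewrite !big_bool /=; under [in RHS]eq_bigr => d _ do rewrite mulrnDl.
rewrite big_split /= -/(H true) -/(H false) addn1 expnS mulnC mulrnA mulr2n mulrnDl.
by rewrite [(H false *+ _ + _)%R]addrC.
Qed.

Local Open Scope ring_scope.

Theorem theorem9 : forall n : nat, (1 <= n)%N ->
  partial_dual_genus_poly (C_bouquet n) =
    (2 ^ (n + 1) * (n + 2))%:R *: 'X^(2 * n + 2)
    + \sum_(2 <= s < n.+1)
        (2 ^ (n + 1) * ('C(n, s) + 'C(n, s - 1)))%:R *: 'X^(2 * n - 2 * s + 4)
    + (2 ^ (n + 1))%:R *: 'X^2.
Proof.
move=> n n_gt0; rewrite /partial_dual_genus_poly.
pose F (b : bool) d : {poly int} :=
  'X^(2 * n + 4 - 2 * (if b then d.+1 else maxn d 1)).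
rewrite (eq_bigr (fun A =>
  F (bit_of A 0 == bit_of A 1) (nmixed (bit_of A) n))) => [|A _]; last first.
  by rewrite euler_genus_C.
rewrite (sum_over_profiles n F).
pose mid (s : nat) : {poly int} := 'X^(2 * n - 2 * s + 4).
(* With [d] mixed pairs there are [s = d + 1] circles in the first case and
   [s = d] in the second, except that [d = 0] and [d = 1] both give one there. *)
have FtE d : (d < n)%N -> F true d = mid d.+1.
  by move=> dn; congr ('X^_); lia.
have FfE d : (1 < d < n.+1)%N -> F false d = mid d.
  by move=> dn; congr ('X^_); rewrite (maxn_idPl _); lia.
have F0 b : F b 0%N = 'X^(2 * n + 2) by case: b; congr ('X^_); lia.
have F1 : F false 1%N = 'X^(2 * n + 2) by congr ('X^_); lia.
have Fn : F true n = 'X^2 by congr ('X^_); lia.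
have sum_true : \sum_(0 <= d < n.+1) F true d *+ 'C(n, d) =
    'X^(2 * n + 2) + \sum_(2 <= s < n.+1) mid s *+ 'C(n, s - 1) + 'X^2.
  rewrite big_nat_recr //= Fn binn big_ltn // F0 bin0 [in RHS]big_add1 /=.
  congr (_ + _ + _); apply: eq_big_nat => d /andP[_ dn].
  by rewrite FtE // subn1.
have sum_false : \sum_(0 <= d < n.+1) F false d *+ 'C(n, d) =
    'X^(2 * n + 2) *+ (n + 1) + \sum_(2 <= s < n.+1) mid s *+ 'C(n, s).
  rewrite big_ltn // big_ltn // F0 F1 bin0 bin1 addrA -mulrnDr [(1 + n)%N]addnC.
  by congr (_ + _); apply: eq_big_nat => d dn; rewrite FfE.
under eq_bigr => d _ do rewrite mulrnDl.
rewrite big_split /= sum_true sum_false !scaler_nat.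
under [in RHS]eq_bigr => s _ do
  rewrite scaler_nat [(2 ^ _ * _)%N]mulnC mulrnA mulrnDr -/(mid s).
rewrite sumrMnl big_split /= [(2 ^ _ * _)%N]mulnC mulrnA -!mulrnDl; congr (_ *+ _).
rewrite [(n + 2)%N]addnS mulrS.
by rewrite [LHS]addrAC [X in X + _ = _]addrACA [X in _ + X + _ = _]addrC.
Qed.
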